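(* Let $n \geq 1$ and let $A = (a_{i,j})$ be an $n \times n$ matrix that is the antiadjacency matrix of a unit interval order, i.e. $A \in \mathcal{A}_n$. Fix $h \in [n] = \{1,\dotsc,n\}$ and define the sets $J = \{1,\dotsc,h\}$, $\bar J = [n] \setminus J$, $I = [n] \cap 2\mathbb{Z}$ (the even elements of $[n]$), and $\bar I = [n] \setminus I$ (the odd elements of $[n]$). Then $$\mathrm{per}(A_{J,J})\,\mathrm{per}(A_{\bar J,\bar J}) \;\geq\; \mathrm{per}(A_{I,I})\,\mathrm{per}(A_{\bar I,\bar I}).$$
   Context: For an $n\times n$ matrix $A=(a_{i,j})$ and $I,J \subseteq [n]$, $A_{I,J} = (a_{i,j})_{i\in I, j\in J}$ denotes the $(I,J)$-submatrix. $\mathrm{per}$ denotes the permanent; the permanent of the empty ($0\times 0$) matrix is $1$. $\mathcal{A}_n$ is the set of $n\times n$ matrices with entries in $\{0,1\}$ that are weakly increasing down each column ($a_{i,j}\le a_{i+1,j}$), weakly decreasing along each row from left to right ($a_{i,j}\ge a_{i,j+1}$), and have all entries on or below the diagonal equal to $1$. Unit interval orders on $n$ elements (posets with no induced subposet isomorphic to $\mathbf 3+\mathbf 1$ or $\mathbf 2+\mathbf 2$) correspond bijectively (up to isomorphism) to matrices $A\in\mathcal{A}_n$: the poset $P(A)$ on $[n]$ is given by $i <_{P(A)} j$ if and only if $a_{i,j}=0$, and $A$ is called the antiadjacency matrix of $P(A)$. Thus the antiadjacency matrices of $n$-element unit interval orders are exactly the elements of $\mathcal{A}_n$. *)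

(* Defs.v *)
From HB Require Import structures.
From mathcomp Require Import all_boot all_order all_algebra all_fingroup.
Set Implicit Arguments.
Unset Strict Implicit.
Unset Printing Implicit Defensive.
Import Order.TTheory GRing.Theory Num.Theory.
Local Open Scope ring_scope.

(* The ordinal i : 'I_n stands for the element i.+1 of [n] = {1, ..., n}. *)

Definition permanent (R : comNzRingType) (n : nat) (A : 'M[R]_n) : R :=
  \sum_(s : 'S_n) \prod_(i < n) A i (s i).

(* enum_val lists the elements of a subset of 'I_n in increasing order. *)
Definition setsubmx (R : Type) (n : nat) (I J : {set 'I_n}) (A : 'M[R]_n) :
    'M[R]_(#|I|, #|J|) :=
  mxsub (enum_val (A := I)) (enum_val (A := J)) A.

(* The class written \mathcal{A}_n: the antiadjacency matrices of the unit
   interval orders on [n], where i precedes j if and only if A i j = 0. *)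
Definition antiadjacency (n : nat) (A : 'M[int]_n) : Prop :=
  [/\ forall i j : 'I_n, A i j = 0 \/ A i j = 1,
      forall i i' j : 'I_n, i' = i.+1 :> nat -> A i j <= A i' j,
      forall i j j' : 'I_n, j' = j.+1 :> nat -> A i j' <= A i j &
      forall i j : 'I_n, (j <= i)%N -> A i j = 1].

Definition initial_set (n h : nat) : {set 'I_n} :=
  [set i : 'I_n | (i.+1 <= h)%N].

Definition even_set (n : nat) : {set 'I_n} :=
  [set i : 'I_n | ~~ odd i.+1].

(* Main.v *)
Require Import Defs.
From HB Require Import structures.
From mathcomp Require Import all_boot all_order all_algebra all_fingroup.
From mathcomp Require Import zify ring.
Set Implicit Arguments.
Unset Strict Implicit.
Unset Printing Implicit Defensive.
Import Order.TTheory GRing.Theory Num.Theory.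

(** Number rows and columns from 0, let r i be the number of ones in row i of A,
    and let c i = r i - i be the number of them on or right of the diagonal.

    All rows are initial segments and they grow downwards, so a permanent is
    computed greedily: if rows 0, ..., i - 1 have been given columns, these
    all lie in the support of row i, which therefore has c i choices left.
    Hence per A is the product of the c i, and since principal submatrices keep
    the relevant structure, per A_{S,S} is the product over i in S of the number
    of ones of row i in the columns of S from i on ([permanent_setsubmx]).
    That number is min (c i) (h - i) for S = J, it is c i for the complement of
    J, and it is ceil (c i / 2) in both parity classes.  The theorem becomes
      prod_{i < n} ceil (c i / 2)
        <= prod_{i < h} min (c i) (h - i) * prod_{h <= i < n} c i,
    in which the monotonicity of r survives as c i <= c (i + 1) + 1.

    Factors with i < h may favour the left side, by an amount which depends on
    the overhang m = r (h - 1) - h of the last row of J.  As r increases,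
    c (h - 1 - k) <= m + k + 1, and therefore ([prod_head_le])
      m! * prod_{i < h} ceil (c i / 2)
        <= prod_{i < h} min (c i) (h - i) * prod_{k < m} ceil ((m + k + 1) / 2).
    The same overhang forces c h >= m; from there c descends to 0 in steps of
    at most one, so it takes values that compensate for the loss
    ([prod_tail_le]):
      m! * prod_{h <= i < n} ceil (c i / 2)
        <= prod_{x < m} ceil ((x + 1) / 2) * prod_{h <= i < n} c i.
    The two correction products combine to prod_{x < 2m} ceil ((x + 1) / 2),
    which is exactly m! ^ 2 ([prod_uphalf_double]), so that multiplying the two
    estimates and cancelling m! ^ 2 gives the claim. *)

(** * The product inequality *)

Lemma prod_uphalf_double (m : nat) :
  \prod_(x < m + m) uphalf x.+1 = m`! * m`!.
Proof.
elim: m => [|m IHm]; first by rewrite big_ord0.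
have [u1 u2] : uphalf (m + m).+1 = m.+1 /\ uphalf (m + m).+2 = m.+1 by lia.
move: u1 u2 => /= u1 u2.
by rewrite addSn addnS !big_ord_recr /= IHm u1 u2 !factS; ring.
Qed.

(** Both products vanish if some c (a + i) does; otherwise every factor gains
    c / uphalf c >= 1, and while descending from c a to 0 in steps
    of at most one, c takes each of the values m, ..., 1, and the gains at these
    values alone multiply to m! / prod_{x < m} uphalf (x + 1). *)
Lemma prod_tail_le (c : nat -> nat) (k a m : nat) :
  (forall i, c i <= (c i.+1).+1) -> c (a + k) = 0 -> m <= c a ->
  m`! * \prod_(i < k) uphalf (c (a + i)) <=
  (\prod_(x < m) uphalf x.+1) * \prod_(i < k) c (a + i).
Proof.
move=> cS; elim: k a m => [|k IHk] a m.
  by rewrite addn0 => ->; rewrite leqn0 => /eqP ->; rewrite !big_ord0.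
rewrite -addSnnS => ck0 le_mc.
rewrite !(big_ord_recl k) /= !addn0.
under eq_bigr do rewrite /bump /= add1n -addSnnS.
under [X in _ <= _ * (_ * X)]eq_bigr do rewrite /bump /= add1n -addSnnS.
have [le_mc1 | lt_c1m] := leqP m (c a.+1).
  rewrite mulnCA [leqRHS]mulnCA.
  by apply: leq_mul (IHk _ _ ck0 le_mc1); lia.
(* If m exceeds c a.+1, the slow descent leaves only m = c a = (c a.+1).+1: the
   first factor then pays for the factor m of m!, and m.-1 remains. *)
have eq_m : m = c a by have := cS a; lia.
rewrite -eq_m; case: m => [//|m] in le_mc lt_c1m eq_m *.
rewrite factS big_ord_recr /= [leqLHS]mulnACA.
set H := \prod_(x < m) _; rewrite [H * _]mulnC [leqRHS]mulnACA.
rewrite [X in X * _ <= _]mulnC.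
have le_mc1 : m <= c a.+1 by have := cS a; lia.
by apply: leq_mul (IHk _ m ck0 le_mc1).
Qed.

(** The index k counts rows upwards from the last row of the initial block, and
    m is the overhang of that row.  For k >= m the factor uphalf (e k) is at
    most k.+1 and needs no correction; for k < m it can exceed minn (e k) k.+1,
    but by a factor of at most uphalf (m + k).+1 / k.+1.  The product has at
    least m factors so that the whole of m! is split among them. *)
Lemma prod_head_le (e : nat -> nat) (m t : nat) :
  (forall k, e k <= (m + k).+1) ->
  m`! * \prod_(k < m + t) uphalf (e k) <=
  (\prod_(k < m + t) minn (e k) k.+1) * \prod_(k < m) uphalf (m + k).+1.
Proof.
move=> le_e; rewrite !big_split_ord /= mulnA [leqRHS]mulnAC.
apply: leq_mul; last first.
  by apply: leq_prod => k _; have := le_e (m + k); lia.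
rewrite fact_prod big_add1 big_mkord -!big_split /=.
apply: leq_prod => k _; have := le_e k; have := ltn_ord k => lt_km le_ek.
have [le_ek1 | lt_k1e] := leqP (e k) k.+1.
  rewrite mulnC; apply: leq_mul; lia.
apply: leq_mul => //; lia.
Qed.

(** The two sides are the products of permanents for the row gaps c i: the two
    parity classes together on the left, an initial block and its complement on
    the right. *)
Lemma prod_uphalf_le (c : nat -> nat) (n h : nat) :
  (forall i, c i <= (c i.+1).+1) -> c n = 0 -> h <= n ->
  \prod_(i < n) uphalf (c i) <=
  (\prod_(i < h) minn (c i) (h - i)) * \prod_(i < n - h) c (h + i).
Proof.
move=> cS cn0 le_hn.
case: h => [|h] in le_hn *.
  by rewrite big_ord0 mul1n subn0; apply: leq_prod => i _; rewrite add0n; lia.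
(* The rows of the block are listed from the last one upwards, and padded by
   factors 1 so that their number is at least m even when m exceeds h.+1. *)
pose m := (c h).-1; pose e k := if k <= h then c (h - k) else 1.
have le_c k : k <= h -> c (h - k) <= c h + k.
  elim: k => [|k IHk] le_kh; first by rewrite subn0 addn0.
  have := cS (h - k.+1); have -> : (h - k.+1).+1 = h - k by lia.
  by have := IHk (ltnW le_kh); lia.
have le_e k : e k <= (m + k).+1.
  by rewrite /e /m; case: ifP => [/le_c|_]; lia.
have := prod_head_le h.+1 le_e.
have le_mch : m <= c h.+1 by rewrite /m; have := cS h; lia.
have := prod_tail_le (k := n - h.+1) cS _ le_mch.
rewrite subnKC // => /(_ cn0).
have prod_e (F : nat -> nat -> nat) : (forall k, F 1 k = 1) ->
    \prod_(k < m + h.+1) F (e k) k = \prod_(i < h.+1) F (c i) (h - i).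
  move=> F1; rewrite addnC big_split_ord /= [X in _ * X]big1 ?muln1; last first.
    by move=> k _; rewrite /e ifN ?F1 //; lia.
  rewrite (reindex_inj rev_ord_inj) /=; apply: eq_bigr => i _.
  by rewrite /e subSS leq_subr subKn // -ltnS.
rewrite (prod_e (fun x _ => uphalf x)) // (prod_e (fun x k => minn x k.+1)); last by lia.
have := prod_uphalf_double m; rewrite big_split_ord /=.
have -> : \prod_(i < n) uphalf (c i) =
  (\prod_(i < h.+1) uphalf (c i)) * \prod_(i < n - h.+1) uphalf (c (h.+1 + i)).
  by rewrite -[in LHS](subnKC le_hn) big_split_ord.
have -> : \prod_(i < h.+1) minn (c i) (h.+1 - i) =
  \prod_(i < h.+1) minn (c i) (h - i).+1.
  by apply: eq_bigr => i _; rewrite subSn // -ltnS.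
move=> HG le_up le_lo.
rewrite -(leq_pmul2l (_ : 0 < m`! * m`!)); last by rewrite muln_gt0 fact_gt0.
rewrite mulnACA (leq_trans (leq_mul le_lo le_up)) // -HG eq_leq //; ring.
Qed.

Lemma count_same_parity (i m : nat) :
  \sum_(i <= j < i + m | odd j == odd i) 1 = uphalf m.
Proof.
rewrite -{1}[i]add0n [i + m]addnC big_addn addnK big_mkcond /=.
elim: m => [|m IHm]; first by rewrite big_geq.
rewrite big_nat_recr //= IHm oddD uphalf_half; case: (odd i) (odd m) => [] [] /=; lia.
Qed.

(** * Permanents of matrices with nested rows *)

Lemma leq_enum_val (n : nat) (S : {set 'I_n}) (p q : 'I_#|S|) :
  (enum_val p <= enum_val q) = (p <= q).
Proof.
have enum_sorted : sorted ltn (map val (enum S)).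
  rewrite -[enum _](eq_filter (mem_enum _)).
  rewrite -(eq_filter (mem_map val_inj _)) -filter_map.
  by rewrite (sorted_filter ltn_trans) // unlock val_ord_enum iota_ltn_sorted.
have homo (p' q' : 'I_#|S|) : p' < q' -> enum_val p' < enum_val q'.
  have val_nth (i : 'I_#|S|) : val (enum_val i) = nth 0 (map val (enum S)) i.
    by rewrite (nth_map (enum_val i)) -?cardE // -enum_val_nth.
  rewrite !val_nth => lt_pq.
  by apply: (sorted_ltn_nth ltn_trans) => //; rewrite inE size_map -cardE.
have [le_pq | /homo] := leqP p q; last by rewrite ltnNge => /negbTE.
by case: (ltngtP p q) le_pq => // [/homo/ltnW -> // | /val_inj ->]; rewrite leqnn.
Qed.

Local Open Scope ring_scope.

(** Nestedness of the supports refers only to the order of the rows, and ones on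
    and below the diagonal only to the order of the indices: both therefore pass
    to all principal submatrices. *)
Definition nested_rows (R : comNzRingType) (n : nat) (B : 'M[R]_n) : Prop :=
  (forall i j : 'I_n, (j <= i)%N -> B i j = 1) /\
  (forall i j : 'I_n, B i j = 0 \/
     forall i' : 'I_n, (i <= i')%N -> B i' j = 1).

Lemma permanent_fixed_first (R : comNzRingType) (n : nat) (B : 'M[R]_n.+1) :
  \sum_(s : 'S_n.+1 | s ord0 == ord0) \prod_(i < n) B (lift ord0 i) (s (lift ord0 i)) =
  permanent (row' ord0 (col' ord0 B)).
Proof.
have lift_inj_perm : injective (@lift_perm n ord0 ord0).
  move=> t1 t2 eq_t; apply/permP=> k; apply: (@lift_inj _ ord0).
  by rewrite -!(lift_perm_lift ord0 ord0) eq_t.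
have lift_onto (s : 'S_n.+1) : s ord0 = ord0 ->
    exists t, lift_perm ord0 ord0 t = s.
  move=> s0; have s_lift k : {k' | s (lift ord0 k) = lift ord0 k'}.
    have /unlift_some[k' eq_k' _] : ord0 != s (lift ord0 k); last by exists k'.
    by rewrite -{1}s0 (inj_eq perm_inj) neq_lift.
  have inj_f : injective (fun k => sval (s_lift k)).
    move=> k1 k2 /(congr1 (lift ord0)); rewrite -!(svalP (s_lift _)).
    by move/perm_inj/lift_inj.
  exists (perm inj_f); apply/permP=> k.
  case: (unliftP ord0 k) => [k'|] ->; last by rewrite lift_perm_id.
  by rewrite lift_perm_lift permE -(svalP (s_lift k')).
rewrite /permanent (reindex (@lift_perm n ord0 ord0)); last first.
  exists (fun s => odflt 1%g [pick t | lift_perm ord0 ord0 t == s]) => [t _|s].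
    by case: pickP => [t' /eqP/lift_inj_perm // | /(_ t)]; rewrite eqxx.
  move=> /eqP/lift_onto[t <-].
  by case: pickP => [t' /eqP // | /(_ t)]; rewrite eqxx.
apply: eq_big => [s|s _]; first by rewrite lift_perm_id eqxx.
by apply: eq_bigr => i _; rewrite lift_perm_lift !mxE.
Qed.

(** If B ord0 j is nonzero then the columns j and ord0 are both constant 1.
    Exchanging them turns permutations which send ord0 to j into permutations
    which fix ord0, and leaves all factors below the first row unchanged: each
    choice of j contributes the same permanent. *)
Lemma permanent_nested_first (R : comNzRingType) (n : nat) (B : 'M[R]_n.+1) :
  nested_rows B ->
  permanent B = (\sum_j B ord0 j) * permanent (row' ord0 (col' ord0 B)).
Proof.
case=> Blow Bnest; rewrite -permanent_fixed_first mulr_suml /permanent.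
rewrite (partition_big (fun s : 'S_n.+1 => s ord0) predT) //=.
apply: eq_bigr => j _.
rewrite (reindex_inj (mulIg (tperm ord0 j))) /= mulr_sumr.
apply: eq_big => [s|s /eqP s0].
  by rewrite permM -{2}(tpermL ord0 j) (inj_eq perm_inj).
rewrite big_ord_recl s0.
case: (Bnest ord0 j) => [-> | B1]; first by rewrite !mul0r.
congr (_ * _); apply: eq_bigr => i _; rewrite permM.
case: tpermP => [-> | -> | //]; by rewrite B1 // Blow.
Qed.

Lemma permanent_nested (R : comNzRingType) (n : nat) (B : 'M[R]_n) :
  nested_rows B ->
  permanent B = \prod_(i < n) \sum_(j < n | (i <= j)%N) B i j.
Proof.
elim: n B => [|n IHn] B nB.
  rewrite big_ord0 /permanent (big_pred1 1%g) ?big_ord0 // => s.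
  by apply/esym/eqP/permP; case.
rewrite permanent_nested_first // big_ord_recl; congr (_ * _).
rewrite IHn; last first.
  case: nB => Blow Bnest; split=> i j; rewrite !mxE.
    by move=> le_ji; apply: Blow; rewrite !lift0.
  case: (Bnest (lift ord0 i) (lift ord0 j)) => [->|B1]; [by left | right].
  by move=> i' le_ii'; rewrite !mxE B1.
apply: eq_bigr => i _; rewrite [RHS]big_mkcond big_ord_recl /= add0r.
rewrite [LHS]big_mkcond; apply: eq_bigr => j _.
by rewrite !mxE.
Qed.

Lemma permanent_setsubmx (R : comNzRingType) (n : nat) (B : 'M[R]_n)
    (S : {set 'I_n}) : nested_rows B ->
  permanent (setsubmx S S B) =
  \prod_(i in S) \sum_(j in S | (i <= j)%N) B i j.
Proof.
case=> Blow Bnest; rewrite permanent_nested; last first.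
  split=> p q; rewrite !mxE; first by rewrite -leq_enum_val; exact: Blow.
  case: (Bnest (enum_val p) (enum_val q)) => [->|B1]; [by left | right].
  by move=> p' le_pp'; rewrite !mxE B1 // leq_enum_val.
rewrite [RHS]big_enum_val; apply: eq_bigr => p _.
rewrite [RHS]big_enum_val_cond; apply: eq_big => q; first by rewrite leq_enum_val.
by rewrite !mxE.
Qed.

(** * Antiadjacency matrices *)

(** The row lengths are extended by n beyond the last row, which keeps them
    monotone on all of nat and makes the gap r i - i vanish at i = n. *)
Lemma antiadjacency_row_length (n : nat) (A : 'M[int]_n) :
  (0 < n)%N -> antiadjacency A ->
  exists r : nat -> nat,
    [/\ r n = n, forall i, (r i <= r i.+1)%N, forall i, (r i <= n)%N,
        forall i : 'I_n, (i < r i)%N & forall i j : 'I_n, A i j = (j < r i)%N%:R].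
Proof.
case: n A => [//|n] A _ [A01 Acol Arow Alow].
pose r i := if (i < n.+1)%N then (\max_(j < n.+1 | A (inord i) j == 1) j.+1)%N
            else n.+1.
have r_le i : (r i <= n.+1)%N.
  by rewrite /r; case: ifP => // _; apply/bigmax_leqP => j _; exact: ltn_ord.
have Arow_le i (j j' : 'I_n.+1) : (j <= j')%N -> A i j' <= A i j.
  case: j' => m; elim: m => [|m IHm] lt_mn /= le_jm.
    by rewrite (_ : j = Ordinal lt_mn) //; apply: val_inj => /=; lia.
  case: ltngtP le_jm => // [lt_jm|eq_jm] _; last first.
    by rewrite (_ : j = Ordinal lt_mn) //; apply: val_inj.
  by apply: le_trans (IHm (ltnW lt_mn) lt_jm); apply: Arow.
have Ar (i j : 'I_n.+1) : A i j = (j < r i)%N%:R.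
  rewrite /r ltn_ord inord_val; case: (A01 i j) => Aij; last first.
    have := @leq_bigmax_cond 'I_n.+1 (fun j => A i j == 1) (fun j => j.+1) j.
    by rewrite Aij eqxx => ->.
  rewrite Aij ltnNge (_ : (_ <= _)%N) //; apply/bigmax_leqP => k /eqP Aik.
  rewrite ltnNge; apply/negP => le_jk.
  by have := Arow_le i _ _ le_jk; rewrite Aij Aik.
exists r; split=> //; first by rewrite /r ltnn.
  move=> i; have [lt_i1n | le_ni] := ltnP i.+1 n.+1; last first.
    by rewrite [leqRHS]/r ltnNge le_ni.
  rewrite /r lt_i1n (ltnW lt_i1n); apply/bigmax_leqP => j /eqP Aij.
  have := Acol (inord i) (inord i.+1) j; rewrite Aij !inordK ?(ltnW lt_i1n) //.
  case: (A01 (inord i.+1) j) => [-> /(_ erefl) //|Ai1j _].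
  have := @leq_bigmax_cond 'I_n.+1 (fun j => A (inord i.+1) j == 1) (fun j => j.+1) j.
  by rewrite Ai1j eqxx => ->.
by move=> i; have := Ar i i; rewrite Alow //; case: ltnP.
Qed.

Lemma permanent_row_length (R : comNzRingType) (n : nat) (B : 'M[R]_n)
    (r : nat -> nat) (P : pred nat) (S : {set 'I_n}) :
  (forall i, (r i <= r i.+1)%N) -> (forall i, (r i <= n)%N) ->
  (forall i : 'I_n, (i < r i)%N) ->
  (forall i j : 'I_n, B i j = (j < r i)%N%:R) ->
  (forall i : 'I_n, (i \in S) = P i) ->
  permanent (setsubmx S S B) =
  (\prod_(i < n | P i) \sum_(i <= j < r i | P j) 1)%N%:R.
Proof.
move=> r_mono r_le r_diag Br SP; rewrite permanent_setsubmx.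
  rewrite natr_prod; apply: eq_big => // i _.
  rewrite big_geq_mkord (big_ord_widen_cond n (fun j => P j && (i <= j)%N) (fun=> 1%N)) //.
  rewrite natr_sum [RHS]big_mkcondr; apply: eq_big => j; first by rewrite SP.
  by rewrite Br; case: ltnP.
have r_homo : {homo r : i j / (i <= j)%N} by apply: homo_leq leq_trans r_mono.
split=> i j; rewrite Br.
  by move=> le_ji; rewrite (leq_ltn_trans le_ji).
case: ltnP => [lt_jr | _]; [right=> i' le_ii' | by left].
by rewrite Br (leq_trans lt_jr) // r_homo.
Qed.

Theorem theorem5p1 (n : nat) (hn : (1 <= n)%N) (A : 'M[int]_n)
    (hA : antiadjacency A) (h : nat) (hh : (1 <= h <= n)%N) :
  let J := initial_set n h in
  let I := even_set n in
  permanent (setsubmx J J A) * permanent (setsubmx (~: J) (~: J) A) >=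
  permanent (setsubmx I I A) * permanent (setsubmx (~: I) (~: I) A).
Proof.
cbv zeta; have [_ le_hn] := andP hh.
have [r [rn r_mono r_le r_diag Ar]] := antiadjacency_row_length hn hA.
have perE := permanent_row_length r_mono r_le r_diag Ar.
rewrite (perE (fun i => i < h)%N (initial_set n h)) => [|i]; last by rewrite inE.
rewrite (perE (fun i => h <= i)%N (~: initial_set n h)) => [|i]; last by rewrite !inE -leqNgt.
rewrite (perE odd (even_set n)) => [|i]; last by rewrite inE /= negbK.
rewrite (perE (fun i => ~~ odd i) (~: even_set n)) => [|i]; last by rewrite !inE /= negbK.
rewrite -!natrM ler_nat.
have countE i : (\sum_(i <= j < r i | odd j == odd i) 1 = uphalf (r i - i))%N.
  have [le_ir | lt_ri] := leqP i (r i); last by rewrite big_geq; lia.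
  by rewrite -{1}(subnKC le_ir) count_same_parity.
have -> : (\prod_(i < n | odd i) (\sum_(i <= j < r i | odd j) 1) *
           \prod_(i < n | ~~ odd i) (\sum_(i <= j < r i | ~~ odd j) 1) =
           \prod_(i < n) uphalf (r i - i))%N.
  rewrite [RHS](bigID (fun i : 'I_n => odd i)) /=; congr (_ * _)%N;
    apply: eq_bigr => i odd_i; rewrite -countE; apply: eq_bigl => j.
    by rewrite odd_i eqb_id.
  by rewrite (negbTE odd_i) eqbF_neg.
have -> : (\prod_(i < n | i < h) \sum_(i <= j < r i | j < h) 1 =
           \prod_(i < h) minn (r i - i) (h - i))%N.
  rewrite [RHS](big_ord_widen n (fun i => minn (r i - i) (h - i))) //.
  apply: eq_bigr => i _.
  have -> : (\sum_(i <= j < r i | j < h) 1 = \sum_(i <= j < minn (r i) h) 1)%N.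
    rewrite [RHS](big_nat_widen _ _ (r i)) ?geq_minl // big_nat_cond [RHS]big_nat_cond.
    by apply: eq_bigl => j; lia.
  by rewrite sum_nat_const_nat muln1; lia.
have -> : (\prod_(i < n | h <= i) \sum_(i <= j < r i | h <= j) 1 =
           \prod_(i < n - h) (r (h + i) - (h + i)))%N.
  rewrite -(big_geq_mkord h n xpredT (fun i => \sum_(i <= j < r i | h <= j) 1)%N).
  rewrite -{1}[h]add0n big_addn big_mkord.
  apply: eq_bigr => i _; rewrite (addnC i).
  have -> : (\sum_(h + i <= j < r (h + i) | h <= j) 1 = \sum_(h + i <= j < r (h + i)) 1)%N.
    by rewrite big_nat_cond [RHS]big_nat_cond; apply: eq_bigl => j; lia.
  by rewrite sum_nat_const_nat muln1.
apply: (prod_uphalf_le (c := fun i => (r i - i)%N)) => //.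
  by move=> i; have := r_mono i; lia.
by rewrite rn subnn.
Qed.
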